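(* Let $p$ denote an arbitrary prime. (a) Every abelian group has an integral which is nilpotent of class $2$. (b) Every finite abelian $p$-group has a $p$-integral which is finite and nilpotent of class $2$. (c) Every abelian $p$-group has a $p$-integral which is a nilpotent $p$-group of class $2$. (d) Every periodic abelian group has an integral that is periodic and nilpotent of class $2$.
   Context: For a group $H$, $H'$ denotes the derived group (commutator subgroup) of $H$. An integral of a group $G$ is a group $H$ such that $H' \cong G$. A $p$-group (finite or infinite) is a group in which every element has order a power of $p$. A $p$-integral of a $p$-group is an integral of it which is itself a $p$-group. A group is periodic if all its elements have finite order. A group is nilpotent of class $2$ if and only if its derived group is nontrivial and central.
   Formalization: In all four parts, nilpotency of class exactly 2 is claimed only for nontrivial groups; every integral of the trivial group has trivial derived group, so it cannot be of class 2, and for it only the existence of the integral is claimed. *)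

(* Defs.v *)
From mathcomp Require Import all_boot all_fingroup all_solvable.

Set Implicit Arguments.
Unset Strict Implicit.
Unset Printing Implicit Defensive.

Local Open Scope group_scope.

Definition abelian_group (G : groupType) : Prop :=
  forall x y : G, commute x y.

Definition nontrivial_group (G : groupType) : Prop :=
  exists x : G, x <> 1.

Inductive derived (H : groupType) : H -> Prop :=
  | derived_commg x y : derived [~ x, y]
  | derived1 : derived 1
  | derivedM x y : derived x -> derived y -> derived (x * y)
  | derivedV x : derived x -> derived x^-1.

(* The isomorphism of G with H' is given as an injective morphism into H     *)
(* whose image is exactly H'.                                                *)
Definition integral (G H : groupType) : Prop :=
  exists f : {multiplicative G -> H},
    injective f /\ forall y : H, derived y <-> exists x : G, f x = y.

Definition has_order (G : groupType) (x : G) (n : nat) : Prop :=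
  [/\ (0 < n)%N, x ^+ n = 1 & forall m : nat, (0 < m < n)%N -> x ^+ m <> 1].

Definition periodic_group (G : groupType) : Prop :=
  forall x : G, exists n : nat, has_order x n.

Definition is_pgroup (p : nat) (G : groupType) : Prop :=
  forall x : G, exists k : nat, has_order x (p ^ k)%N.

Definition p_integral (p : nat) (G H : groupType) : Prop :=
  integral G H /\ is_pgroup p H.

(* Class exactly 2. An integral of the trivial group is abelian, so it can    *)
(* never have this property; it is only to be expected for nontrivial G.     *)
Definition nilpotent_class2 (H : groupType) : Prop :=
  (exists2 x : H, derived x & x <> 1)
  /\ (forall x y : H, derived x -> commute x y).

(* On finite groups these notions agree with the finite group library.       *)
Lemma derived_finE (gT : finGroupType) (x : gT) :
  derived x <-> x \in [set: gT]^`(1).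
Proof.
rewrite derg1; split=> [|/gen_prodgP[n [c cP ->]]].
  elim=> [y z||y z _ Hy _ Hz|y _ Hy].
  - by rewrite mem_commg ?inE.
  - exact: group1.
  - exact: groupM.
  - by rewrite groupV.
apply: big_ind => [|y z|i _]; [exact: derived1 | exact: derivedM |].
by have /imset2P[y z _ _ ->] := cP i; exact: derived_commg.
Qed.

Lemma has_order_finE (gT : finGroupType) (x : gT) (n : nat) :
  has_order x n <-> #[x] = n.
Proof.
split=> [[n_gt0 xn1 n_min]|<-]; last first.
  split=> [||m /andP[m_gt0 lt_m_x] xm1]; [exact: order_gt0 | exact: expg_order |].
  move/eqP: xm1; rewrite -order_dvdn => /(dvdn_leq m_gt0).
  by rewrite leqNgt lt_m_x.
have /dvdn_leq-/(_ n_gt0) : #[x] %| n by rewrite order_dvdn xn1.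
rewrite leq_eqVlt => /orP[/eqP //|lt_x_n].
by case: (n_min #[x]); rewrite ?order_gt0 ?lt_x_n ?expg_order.
Qed.

(* Main.v *)
Require Import Defs.
From HB Require Import structures.
From mathcomp Require Import all_boot all_fingroup all_solvable.
From mathcomp Require Import zmodp boolp.

(** Every construction below is a Heisenberg group.  Given abelian groups U, V,
    A and a bimultiplicative map b : U -> V -> A, the set U * V * A with
    (u, v, a) (u', v', a') = (u u', v v', a a' b(u, v')) is a group whose
    commutators are the elements (1, 1, b(u', v)^-1 b(u, v')).  They lie in the
    central copy of A, and (1, 1, b(u, v)) is the commutator of (u, 1, 1) and
    (1, v, 1).  So if b is onto, the derived group is exactly that copy of A
    ([integral_heis], [nilpotent_class2_heis]), and everything reduces to
    finding onto pairings whose arguments are as small as the statement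
    requires.

    Torsion is measured by a set E of exponents closed under products: a group
    is E-torsion if each of its elements is killed by an exponent in E.  With
    E all of nat (0 included) this says nothing, with E the positive integers
    it says periodic, with E the powers of p it says p-group.  E-torsion passes
    from U, V and A to the Heisenberg group ([torsion_heis]).

    For a finite p-group the pairing is (a, i) |-> a ^+ i with i ranging over a
    cyclic p-group whose order N kills A ([power_pairing]).  For an infinite A
    no single exponent need kill A, and U = A will not do in general: if A is
    a Pruefer group and V is torsion, every bimultiplicative map A -> V -> A
    is trivial, because A is divisible.  Instead U consists of the sequences f
    with f n ^+ n = 1 that are killed by a common exponent of E, and V of the
    morphisms from U to A that are killed by an exponent of E
    ([eval_pairing]).  If a ^+ n = 1 with n in E, then a is the value of the
    n-th coordinate morphism, which n kills, on the sequence equal to a at n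
    and to 1 elsewhere.  As E varies, this pairing serves arbitrary abelian
    groups, abelian p-groups and periodic abelian groups at once
    ([ex_torsion_integral]). *)

Set Implicit Arguments.
Unset Strict Implicit.
Unset Printing Implicit Defensive.

Local Open Scope group_scope.

(** * Heisenberg groups *)

Record pairing (U V A : groupType) := Pairing {
  pairing_fun :> U -> V -> A;
  pairing_abelianl : abelian_group U;
  pairing_abelianr : abelian_group V;
  pairing_abelian : abelian_group A;
  pairingMl : forall v, {morph pairing_fun^~ v : u u' / u * u'};
  pairingMr : forall u, {morph pairing_fun u : v v' / v * v'} }.

Section Heisenberg.

Variables (U V A : groupType) (b : pairing U V A).

Lemma pairing1l v : b 1 v = 1.
Proof. by apply: (@mulgI _ (b 1 v)); rewrite -pairingMl !mulg1. Qed.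

Lemma pairing1r u : b u 1 = 1.
Proof. by apply: (@mulgI _ (b u 1)); rewrite -pairingMr !mulg1. Qed.

Lemma pairingVl u v : b u^-1 v = (b u v)^-1.
Proof. by apply: (@mulgI _ (b u v)); rewrite -pairingMl !mulgV pairing1l. Qed.

(** A new name for the triples, since the product type already carries the
    componentwise group law. *)
Definition heis of pairing U V A : Type := (U * V * A)%type.

HB.instance Definition _ := Choice.on (heis b).

Implicit Types x y z : heis b.

Definition heis_mul x y : heis b :=
  (x.1.1 * y.1.1, x.1.2 * y.1.2, x.2 * y.2 * b x.1.1 y.1.2).

Definition heis_one : heis b := (1, 1, 1).

Definition heis_inv x : heis b :=
  (x.1.1^-1, x.1.2^-1, x.2^-1 * b x.1.1 x.1.2).

Fact heis_mulA : associative heis_mul.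
Proof.
move=> [[u v] a] [[u' v'] a'] [[u'' v''] a'']; rewrite /heis_mul /= !mulgA.
have cA := pairing_abelian b; congr (_, _, _).
rewrite pairingMl pairingMr -!mulgA; congr (_ * (_ * _)).
rewrite [RHS]mulgA (cA (b u v') a'') -mulgA; congr (_ * _).
by rewrite [LHS]cA -mulgA.
Qed.

Fact heis_mul1g : left_id heis_one heis_mul.
Proof. by case=> [[u v] a]; rewrite /heis_mul /= !mul1g pairing1l mulg1. Qed.

Fact heis_mulg1 : right_id heis_one heis_mul.
Proof. by case=> [[u v] a]; rewrite /heis_mul /= !mulg1 pairing1r mulg1. Qed.

Fact heis_mulVg : left_inverse heis_one heis_inv heis_mul.
Proof.
case=> [[u v] a]; rewrite /heis_mul /heis_inv /= !mulVg pairingVl.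
by rewrite -(mulgA a^-1) (pairing_abelian b (b u v)) mulgA mulVg mul1g mulgV.
Qed.

Fact heis_mulgV : right_inverse heis_one heis_inv heis_mul.
Proof.
case=> [[u v] a]; rewrite /heis_mul /heis_inv /= !mulgV mulgA mulgV mul1g.
by rewrite -pairingMr mulgV pairing1r.
Qed.

HB.instance Definition _ :=
  isGroup.Build (heis b) heis_mulA heis_mul1g heis_mulg1 heis_mulVg heis_mulgV.

Definition heis_center (a : A) : heis b := (1, 1, a).

Fact heis_centerM : {morph heis_center : a a' / a * a'}.
Proof.
by move=> a a'; congr (_, _, _); rewrite /= ?mulg1 // pairing1l mulg1.
Qed.

HB.instance Definition _ :=
  isMultiplicative.Build A (heis b) heis_center heis_centerM.

Lemma heis_center_inj : injective heis_center.
Proof. by move=> a a' []. Qed.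

Lemma commute_heis_center a y : commute (heis_center a) y.
Proof.
case: y => [[u v] c]; rewrite /commute; congr (_, _, _); rewrite /= ?mulg1 ?mul1g //.
by rewrite pairing1l pairing1r (pairing_abelian b a).
Qed.

Lemma heis_commg x y :
  [~ x, y] = heis_center ((b y.1.1 x.1.2)^-1 * b x.1.1 y.1.2).
Proof.
(* [~ x, y] is the element c with x * y = y * x * c *)
suff e : x * y = y * x * heis_center ((b y.1.1 x.1.2)^-1 * b x.1.1 y.1.2).
  by rewrite commgEl conjgE e -(mulgA y) !mulKg.
case: x y => [[u v] a] [[u' v'] a']; congr (_, _, _) => /=.
- by rewrite mulg1 (pairing_abelianl b u).
- by rewrite mulg1 (pairing_abelianr b v).
by rewrite pairing1r mulg1 (pairing_abelian b a) !mulgA mulgK.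
Qed.

Lemma derived_heis_center y : derived y -> exists a, heis_center a = y.
Proof.
elim=> [{}y z||{}y z _ [a <-] _ [c <-]|{}y _ [a <-]].
- by rewrite heis_commg; eexists.
- by exists 1.
- by exists (a * c); rewrite heis_centerM.
by exists a^-1; apply: (@mulgI _ (heis_center a)); rewrite -heis_centerM !mulgV.
Qed.

Hypothesis b_onto : forall a, exists u v, b u v = a.

Lemma heis_center_derived a : derived (heis_center a).
Proof.
have [u [v <-]] := b_onto a.
suff -> : heis_center (b u v) = [~ (u, 1, 1) : heis b, (1, v, 1) : heis b].
  exact: derived_commg.
by rewrite heis_commg /= pairing1l invg1 mul1g.
Qed.

Lemma integral_heis : integral A (heis b).
Proof.
exists heis_center; split=> [|y]; first exact: heis_center_inj.
by split=> [/derived_heis_center|[a <-]] //; apply: heis_center_derived.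
Qed.

Lemma nilpotent_class2_heis : nontrivial_group A -> nilpotent_class2 (heis b).
Proof.
case=> a a_neq1; split.
  exists (heis_center a); first exact: heis_center_derived.
  by case.
by move=> x y /derived_heis_center[c <-]; apply: commute_heis_center.
Qed.

End Heisenberg.

HB.instance Definition _ (U V A : finGroupType) (b : pairing U V A) :=
  Finite.on (heis b).

(** * Torsion relative to a set of exponents *)

Definition exponents (E : nat -> Prop) : Prop :=
  E 1%N /\ forall m n, E m -> E n -> E (m * n)%N.

Definition torsion (E : nat -> Prop) (G : groupType) : Prop :=
  forall x : G, exists2 n, E n & x ^+ n = 1.

(** Raising to an exponent that kills the U- and V-components lands in the
    central copy of A, where an exponent for A finishes. *)
Lemma torsion_heis E (U V A : groupType) (b : pairing U V A) :
  exponents E -> torsion E U -> torsion E V -> torsion E A -> torsion E (heis b).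
Proof.
move=> [_ EM] tU tV tA x.
have [k Ek uk] := tU x.1.1; have [l El vl] := tV x.1.2.
have x1n n : (x ^+ n).1 = (x.1.1 ^+ n, x.1.2 ^+ n).
  elim: n => // n IHn; rewrite !expgS.
  by rewrite -[LHS]/(x.1.1 * (x ^+ n).1.1, x.1.2 * (x ^+ n).1.2) IHn.
have [r Er ar] := tA (x ^+ (k * l)).2.
exists (k * l * r)%N; first exact: EM (EM _ _ Ek El) Er.
have xE : x ^+ (k * l) = heis_center b (x ^+ (k * l)).2.
  rewrite [LHS]surjective_pairing; congr (_, _).
  by rewrite x1n expgnA uk expg1n mulnC expgnA vl expg1n.
rewrite expgnA xE.
have -> n a : heis_center b a ^+ n = heis_center b (a ^+ n).
  by elim: n => // n IHn; rewrite !expgS IHn heis_centerM.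
by rewrite ar.
Qed.

Lemma ex_has_order (G : groupType) (x : G) m :
  (0 < m)%N -> x ^+ m = 1 -> exists2 n, n %| m & has_order x n.
Proof.
move=> m_gt0 xm1; have ex_m : exists n, (0 < n)%N && (x ^+ n == 1).
  by exists m; rewrite m_gt0 xm1 eqxx.
case: (ex_minnP ex_m) => n /andP[n_gt0 /eqP xn1] n_min; exists n.
  have: x ^+ (m %% n) = 1.
    by move: xm1; rewrite {1}(divn_eq m n) expgnDr mulnC expgnA xn1 expg1n mul1g.
  rewrite /dvdn; case: posnP => // r_gt0 /eqP xr1.
  by have := n_min (m %% n)%N; rewrite r_gt0 xr1 leqNgt ltn_mod n_gt0 => /(_ isT).
split=> // k /andP[k_gt0 lt_kn] /eqP xk1.
by have := n_min k; rewrite k_gt0 xk1 leqNgt lt_kn => /(_ isT).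
Qed.

Lemma periodic_torsion (G : groupType) :
  periodic_group G <-> torsion (fun n => (0 < n)%N) G.
Proof.
split=> tG x; first by have [n [n_gt0 xn _]] := tG x; exists n.
by have [n n_gt0 /(ex_has_order n_gt0)[m _]] := tG x; exists m.
Qed.

Lemma pgroup_torsion p (G : groupType) : prime p ->
  is_pgroup p G <-> torsion (fun n => exists k, n = p ^ k)%N G.
Proof.
move=> p_pr; split=> tG x.
  by have [k [_ xk _]] := tG x; exists (p ^ k)%N => //; exists k.
have [_ [k ->] xk] := tG x.
have pk_gt0 : (0 < p ^ k)%N by rewrite expn_gt0 prime_gt0.
by have [_ /(dvdn_pfactor _ _ p_pr)[j _ ->]] := ex_has_order pk_gt0 xk; exists j.
Qed.

Lemma exponents_all : exponents (fun=> True).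
Proof. by []. Qed.

Lemma exponents_gt0 : exponents (fun n => (0 < n)%N).
Proof. by split=> // m n m_gt0 n_gt0; rewrite muln_gt0 m_gt0. Qed.

Lemma exponents_pow p : exponents (fun n => exists k, n = p ^ k)%N.
Proof.
by split=> [|_ _ [k ->] [l ->]]; [exists 0%N | exists (k + l)%N; rewrite expnD].
Qed.

(** * Groups of functions *)

Record fun_subgroup (T : Type) (A : groupType) := FunSubgroup {
  in_fun_subgroup :> (T -> A) -> Prop;
  fun_subgroup1 : in_fun_subgroup (fun=> 1);
  fun_subgroupM : forall f g, in_fun_subgroup f -> in_fun_subgroup g ->
    in_fun_subgroup (fun t => f t * g t);
  fun_subgroupV : forall f, in_fun_subgroup f ->
    in_fun_subgroup (fun t => (f t)^-1) }.

Section FunGroup.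

Variables (T : Type) (A : groupType) (S : fun_subgroup T A).

Definition fun_group : Type := {f : T -> A | S f}.

Definition fun_group_app (f : fun_group) : T -> A := sval f.
Coercion fun_group_app : fun_group >-> Funclass.

HB.instance Definition _ := gen_eqMixin fun_group.
HB.instance Definition _ := gen_choiceMixin fun_group.

Implicit Types f g h : fun_group.

Lemma fun_groupP f g : f =1 g -> f = g.
Proof.
by case: f g => [f Sf] [g Sg] /funext /= efg; apply: eq_exist.
Qed.

Definition fun_group_one : fun_group := exist S _ (fun_subgroup1 S).
Definition fun_group_mul f g : fun_group :=
  exist S _ (fun_subgroupM (svalP f) (svalP g)).
Definition fun_group_inv f : fun_group :=
  exist S _ (fun_subgroupV (svalP f)).

Fact fun_group_mulA : associative fun_group_mul.
Proof. by move=> f g h; apply: fun_groupP => t; apply: mulgA. Qed.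

Fact fun_group_mul1g : left_id fun_group_one fun_group_mul.
Proof. by move=> f; apply: fun_groupP => t; apply: mul1g. Qed.

Fact fun_group_mulg1 : right_id fun_group_one fun_group_mul.
Proof. by move=> f; apply: fun_groupP => t; apply: mulg1. Qed.

Fact fun_group_mulVg : left_inverse fun_group_one fun_group_inv fun_group_mul.
Proof. by move=> f; apply: fun_groupP => t; apply: mulVg. Qed.

Fact fun_group_mulgV : right_inverse fun_group_one fun_group_inv fun_group_mul.
Proof. by move=> f; apply: fun_groupP => t; apply: mulgV. Qed.

HB.instance Definition _ := isGroup.Build fun_group
  fun_group_mulA fun_group_mul1g fun_group_mulg1 fun_group_mulVg fun_group_mulgV.

Lemma fun_groupX f n t : fun_group_app (f ^+ n) t = f t ^+ n.
Proof. by elim: n => // n IHn; rewrite !expgS -IHn. Qed.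

Lemma fun_group_abelian : abelian_group A -> abelian_group fun_group.
Proof. by move=> cA f g; apply: fun_groupP => t; apply: cA. Qed.

End FunGroup.

(** * The evaluation pairing *)

Section Evaluation.

Variables (E : nat -> Prop) (A : groupType).
Hypotheses (E_exp : exponents E) (cA : abelian_group A).

(** Boundedness by one exponent is what makes groups of functions E-torsion:
    the pointwise condition would not. *)
Definition bounded (T : Type) (f : T -> A) : Prop :=
  exists2 m, E m & forall t, f t ^+ m = 1.

Lemma bounded1 T : bounded (fun _ : T => 1).
Proof. by exists 1%N => //; case: E_exp. Qed.

Lemma boundedM T (f g : T -> A) :
  bounded f -> bounded g -> bounded (fun t => f t * g t).
Proof.
move=> [m Em fm] [n En gn]; exists (m * n)%N => [|t]; first exact: (proj2 E_exp).
rewrite expgMn; last exact: cA.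
by rewrite expgnA fm expg1n mulnC expgnA gn expg1n mulg1.
Qed.

Lemma boundedV T (f : T -> A) : bounded f -> bounded (fun t => (f t)^-1).
Proof. by case=> m Em fm; exists m => // t; rewrite expVgn fm invg1. Qed.

Lemma bounded_torsion T (S : fun_subgroup T A) :
  (forall f, S f -> bounded f) -> torsion E (fun_group S).
Proof.
move=> bS f; have [m Em fm] := bS _ (svalP f); exists m => //.
by apply: fun_groupP => t; rewrite fun_groupX; apply: fm.
Qed.

Definition torsion_seq (f : nat -> A) : Prop :=
  (forall n, f n ^+ n = 1) /\ bounded f.

Fact torsion_seq1 : torsion_seq (fun=> 1).
Proof. by split=> [n|]; [apply: expg1n | apply: bounded1]. Qed.

Fact torsion_seqM f g :
  torsion_seq f -> torsion_seq g -> torsion_seq (fun n => f n * g n).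
Proof.
move=> [f1 bf] [g1 bg]; split=> [n|]; last exact: boundedM.
by rewrite expgMn ?f1 ?g1 ?mulg1 //; apply: cA.
Qed.

Fact torsion_seqV f : torsion_seq f -> torsion_seq (fun n => (f n)^-1).
Proof.
by move=> [f1 bf]; split=> [n|]; [rewrite expVgn f1 invg1 | apply: boundedV].
Qed.

Definition torsion_seqs := FunSubgroup torsion_seq1 torsion_seqM torsion_seqV.

Definition torsion_morph (phi : fun_group torsion_seqs -> A) : Prop :=
  {morph phi : f g / f * g} /\ bounded phi.

Fact torsion_morph1 : torsion_morph (fun=> 1).
Proof. by split=> [f g|]; [rewrite mulg1 | apply: bounded1]. Qed.

Fact torsion_morphM phi psi : torsion_morph phi -> torsion_morph psi ->
  torsion_morph (fun f => phi f * psi f).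
Proof.
move=> [phiM bphi] [psiM bpsi]; split=> [f g|]; last exact: boundedM.
by rewrite phiM psiM -!mulgA; congr (_ * _); rewrite !mulgA (cA (phi g)).
Qed.

Fact torsion_morphV phi :
  torsion_morph phi -> torsion_morph (fun f => (phi f)^-1).
Proof.
move=> [phiM bphi]; split=> [f g|]; last exact: boundedV.
by rewrite phiM invgM; apply: cA.
Qed.

Definition torsion_morphs :=
  FunSubgroup torsion_morph1 torsion_morphM torsion_morphV.

Definition eval_pairing :
  pairing (fun_group torsion_seqs) (fun_group torsion_morphs) A.
Proof.
apply: (@Pairing _ _ _ (fun f phi => fun_group_app phi f)) => //.
- exact: fun_group_abelian.
- exact: fun_group_abelian.
- by move=> phi; apply: (proj1 (svalP phi)).
Defined.

(** The n-th coordinate morphism is killed by n thanks to the condition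
    f n ^+ n = 1; boundedness alone leaves the exponent of f n dependent on f,
    so that coordinates need not be torsion. *)
Lemma eval_pairing_onto :
  torsion E A -> forall a, exists f phi, eval_pairing f phi = a.
Proof.
move=> tA a; have [n En an] := tA a.
have ts : torsion_seqs (fun k => if k == n then a else 1).
  split=> [k|]; first by case: eqP => [->|_] //; apply: expg1n.
  by exists n => // k; case: eqP => [_|_] //; apply: expg1n.
have tm : torsion_morphs (fun f => f n).
  by split=> [//|]; exists n => // f; apply: (proj1 (svalP f)).
by exists (exist _ _ ts), (exist _ _ tm); rewrite /= /fun_group_app /= eqxx.
Qed.

Lemma ex_torsion_integral : torsion E A -> exists H : groupType,
  [/\ integral A H, torsion E H & nontrivial_group A -> nilpotent_class2 H].
Proof.
move=> tA; exists (heis eval_pairing); split.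
- exact/integral_heis/eval_pairing_onto.
- by apply: torsion_heis => //; apply: bounded_torsion => f [].
exact/nilpotent_class2_heis/eval_pairing_onto.
Qed.

End Evaluation.

(** * The power pairing *)

Section Power.

Variables (G : finGroupType) (n : nat).
Hypotheses (cG : abelian_group G) (Gn : forall x : G, x ^+ n.+1 = 1).

Definition power_pairing : pairing G 'I_n.+1 G.
Proof.
apply: (@Pairing G 'I_n.+1 G (fun x (i : 'I_n.+1) => x ^+ i)) => //.
- by move=> i j; apply: Zp_mulgC.
- by move=> i x y; apply: expgMn.
by move=> x i j; rewrite -expgnDr /= (expg_mod _ (Gn x)).
Defined.

Lemma power_pairing_onto x : exists y i, power_pairing y i = x.
Proof. by exists x, Zp1; rewrite /= (expg_mod _ (Gn x)) expg1. Qed.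

End Power.

Lemma ex_finite_p_integral p (G : finGroupType) : prime p ->
  abelian_group G -> is_pgroup p G ->
  exists H : finGroupType,
    p_integral p G H /\ (nontrivial_group G -> nilpotent_class2 H).
Proof.
move=> p_pr cG pG; have [E1 EM] := exponents_pow p.
(* the product of the orders is a power of p that kills every element *)
pose N := (\prod_(x : G) #[x])%N.
have EN : exists k, N = (p ^ k)%N.
  apply: (big_ind (fun m => exists k, m = p ^ k)%N E1 EM) => x _.
  by have [k /has_order_finE ->] := pG x; exists k.
have N_gt0 : (0 < N)%N by apply: prodn_gt0 => x; apply: order_gt0.
have GN (x : G) : x ^+ N.-1.+1 = 1.
  by apply/eqP; rewrite prednK // -order_dvdn /N (bigD1 x) //= dvdn_mulr.
have onto := power_pairing_onto cG GN.
exists (heis (power_pairing cG GN)); split; last exact: nilpotent_class2_heis.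
split; first exact: integral_heis.
apply/pgroup_torsion => //; apply: torsion_heis => //.
- exact/pgroup_torsion.
- move=> i; exists N => //; apply/eqP; rewrite -order_dvdn.
  by have := order_dvdG (in_setT i); rewrite cardsT card_ord prednK.
- exact/pgroup_torsion.
Qed.

Theorem theorem4p1 (p : nat) (p_prime : prime p) :
  (forall G : groupType, abelian_group G ->
     exists H : groupType,
       integral G H /\ (nontrivial_group G -> nilpotent_class2 H))
  /\ (forall G : finGroupType, abelian_group G -> is_pgroup p G ->
     exists H : finGroupType,
       p_integral p G H /\ (nontrivial_group G -> nilpotent_class2 H))
  /\ (forall G : groupType, abelian_group G -> is_pgroup p G ->
     exists H : groupType,
       p_integral p G H /\ (nontrivial_group G -> nilpotent_class2 H))
  /\ (forall G : groupType, abelian_group G -> periodic_group G ->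
     exists H : groupType,
       [/\ integral G H, periodic_group H
         & nontrivial_group G -> nilpotent_class2 H]).
Proof.
split=> [G cG|].
  (* the exponent 0 is allowed here, and it kills every element *)
  have tG : torsion (fun=> True) G by move=> x; exists 0%N.
  by have [H [iH _ nH]] := ex_torsion_integral exponents_all cG tG; exists H.
split=> [G|]; first exact: ex_finite_p_integral.
split=> G cG.
  move/(pgroup_torsion _ p_prime).
  case/(ex_torsion_integral (exponents_pow p) cG) => H [iH tH nH].
  by exists H; split=> //; split=> //; apply/pgroup_torsion.
move/periodic_torsion/(ex_torsion_integral exponents_gt0 cG) => [H [iH tH nH]].
by exists H; split=> //; apply/periodic_torsion.
Qed.
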